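(* For $\ell=0,1,\ldots,N$ let $$\mathcal{K}_\ell(x,y)=\frac{\exp\big(\frac{\mu g\ell}{2\hbar}\big(\sum_{n=1}^{N-\ell}y_n-\sum_{m=1}^Nx_m\big)\big)}{\prod_{m=1}^N\prod_{n=1}^{N-\ell}[2\cosh(\mu(x_m-y_n)/2)]^{g/\hbar}},\qquad \mathcal{K}_N(x)=\exp\Big(-\frac{\mu gN}{2\hbar}\sum_{m=1}^Nx_m\Big).$$ Then for every $k\in\{1,\ldots,N\}$, $$:\hat\Sigma_k(L_{\rm nr}+E)(x_1,\ldots,x_N):\ \mathcal{K}_\ell(x,y)=\sum_{j=0}^{\min(k,\ell)}c_{\ell,j}\ :\hat\Sigma_{k-j}(L_{\rm nr}+E)(-y_1,\ldots,-y_{N-\ell}):\ \mathcal{K}_\ell(x,y),$$ where $:\hat\Sigma_m(L_{\rm nr}+E)(-y_1,\ldots,-y_{N-\ell}):\equiv0$ for $m>N-\ell$ and $:\hat\Sigma_0(L_{\rm nr}+E):\equiv1$.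
   Context: Fix $\hbar,\mu,g>0$. For $n$ variables $x=(x_1,\ldots,x_n)$ and momenta $p$, let $L_{\rm nr}(x,p)$ be the $n\times n$ matrix $L_{\rm nr}(x,p)_{jk}=\delta_{jk}p_j+(1-\delta_{jk})\frac{i\mu g}{2\sinh(\mu(x_j-x_k)/2)}$ and $E(x)=\mathrm{diag}(z_1(x),\ldots,z_n(x))$ with $z_j(x)=-\frac{i\mu g}{2}\sum_{k\ne j}\coth(\mu(x_j-x_k)/2)$. Let $\Sigma_k(M)$ denote the $k$-th symmetric function of a matrix $M$ (sum of its principal $k\times k$ minors). The normal-ordered operator $:\hat\Sigma_k(L_{\rm nr}+E)(x):$ is the partial differential operator obtained from the polynomial $\Sigma_k(L_{\rm nr}(x,p)+E(x))$ in $p$ by writing all $x$-dependent coefficients to the left of the monomials in $p$ and substituting $p_m\to-i\hbar\partial_{x_m}$. The operator $:\hat\Sigma_k(L_{\rm nr}+E)(-y_1,\ldots,-y_n):$ is obtained from the one in variables $x$ by the substitution $x=-y$ (coefficients evaluated at $-y$, $\partial_{x_m}$ replaced by $-\partial_{y_m}$). Coefficients: $c_{\ell,j}=(i\mu g/2)^jS_j(1,3,\ldots,2\ell-1)$ for $0\le j\le\ell$ (with $S_j$ the $j$-th elementary symmetric function of the $\ell$ numbers $1,3,\ldots,2\ell-1$, $c_{0,0}=1$). The identity is understood for real $x$, $y$ with pairwise distinct coordinates. *)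

(* Defs.v *)
From HB Require Import structures.
From mathcomp Require Import all_boot all_order all_algebra.
From mathcomp Require Import mpoly.
From mathcomp Require Import complex.
From mathcomp Require Import all_classical all_reals all_analysis.

Set Implicit Arguments.
Unset Strict Implicit.
Unset Printing Implicit Defensive.

Import Order.TTheory GRing.Theory Num.Theory.
Local Open Scope ring_scope.
Local Open Scope complex_scope.

Section Defs.
Variable R : realType.
Notation C := (R[i]).

Definition sinhR (t : R) : R := (expR t - expR (- t)) / 2.
Definition coshR (t : R) : R := (expR t + expR (- t)) / 2.
Definition cothR (t : R) : R := coshR t / sinhR t.

Variables (hb mu g : R).

Definition zE (n : nat) (x : 'rV[R]_n) (j : 'I_n) : C :=
  - ('i * (mu * g / 2)%:C) *
    \sum_(k < n | k != j) (cothR (mu * (x 0 j - x 0 k) / 2))%:C.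

(* The matrix L_nr(x,p) + E(x), whose entries are polynomials in the
   commuting momentum variables p_1..p_n (= 'X_1..'X_n) with coefficients
   in C depending on the point x. *)
Definition LnrE (n : nat) (x : 'rV[R]_n) : 'M[mpoly.mpoly n C]_n :=
  \matrix_(j < n, k < n)
    if j == k then (@mpoly.mpolyX n C (@mpoly.mnm1 n j) : mpoly.mpoly n C) + mpoly.mpolyC n (zE x j)
    else mpoly.mpolyC n ('i * (mu * g)%:C / (2 * sinhR (mu * (x 0 j - x 0 k) / 2))%:C).

Definition Sigma (T : comNzRingType) (n k : nat) (M : 'M[T]_n) : T :=
  \sum_(I : {set 'I_n} | #|I| == k)
     \det (mxsub (fun i : 'I_#|I| => enum_val i) (fun i : 'I_#|I| => enum_val i) M).

Definition SigmaPoly (n k : nat) (x : 'rV[R]_n) : mpoly.mpoly n C :=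
  Sigma k (LnrE x).

Definition dpow (n : nat) (i : 'I_n) (e : nat) (f : 'rV[R]_n -> R) : 'rV[R]_n -> R :=
  iter e (fun h => 'D_(delta_mx 0 i) h) f.

Definition dmulti (n : nat) (m : mpoly.multinom n) (f : 'rV[R]_n -> R) : 'rV[R]_n -> R :=
  foldr (fun i h => dpow i (m i) h) f (enum 'I_n).

(* Normal-ordered operator :Sigma_k(L_nr + E)(x): applied to f, evaluated at x:
   coefficients (evaluated at x) to the left, p_m -> -i hb d/dx_m. *)
Definition SigmaOp (n k : nat) (f : 'rV[R]_n -> R) (x : 'rV[R]_n) : C :=
  let P := SigmaPoly k x in
  \sum_(m <- mpoly.msupp P)
     mpoly.mcoeff m P * (- 'i * hb%:C) ^+ mpoly.mdeg m * (dmulti m f x)%:C.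

(* The operator :Sigma_k(L_nr + E)(-y_1,...,-y_n): obtained by the substitution
   x = -y: coefficients evaluated at -y, d/dx_m replaced by - d/dy_m. *)
Definition SigmaOpNeg (n k : nat) (f : 'rV[R]_n -> R) (y : 'rV[R]_n) : C :=
  let P := SigmaPoly k (- y) in
  \sum_(m <- mpoly.msupp P)
     mpoly.mcoeff m P * (- 'i * hb%:C) ^+ mpoly.mdeg m * (-1) ^+ mpoly.mdeg m
       * (dmulti m f y)%:C.

(* The kernel K_l(x,y), x in R^N, y in R^(N-l) (for l = N this is K_N(x)). *)
Definition Kern (N l : nat) (x : 'rV[R]_N) (y : 'rV[R]_(N - l)) : R :=
  expR (mu * g * l%:R / (2 * hb) * (\sum_(n < N - l) y 0 n - \sum_(m < N) x 0 m))
  / \prod_(m < N) \prod_(n < N - l) (2 * coshR (mu * (x 0 m - y 0 n) / 2)) `^ (g / hb).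

Definition esymOdd (l j : nat) : R :=
  \sum_(J : {set 'I_l} | #|J| == j) \prod_(i in J) (2 * i + 1)%:R.

Definition cLJ (l j : nat) : C :=
  ('i * (mu * g / 2)%:C) ^+ j * (esymOdd l j)%:C.

End Defs.

(* Main.v *)
(** Every monomial of [Sigma_k (L_nr + E)] is squarefree in the momenta, and the
    kernel is, up to a constant, a product of functions of one variable each.
    Hence the normal-ordered operator acts on the kernel as multiplication by the
    symmetric function of the matrix in which [p_m] is replaced by the logarithmic
    derivative [beta * (l + \sum_n tanh (mu (x_m - y_n) / 2))], [beta = i mu g / 2],
    and likewise in [y]; the powers of [hbar] cancel.

    With [u = exp (mu x)] and [v = - exp (mu y)], a diagonal gauge turns the two
    matrices (divided by [beta], the second one transposed) into rational matrices
    [A] and [B], and the Cauchy matrix [C = (1 / (u_j - v_k))] satisfies [A C = C B].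
    Completing [C] to a square matrix by the columns [u_j ^ s], [s < l], on which [A]
    acts in a triangular way with diagonal entries [2 s + 1] modulo the columns of
    [C], gives [det (1 + X A) = det (1 + X B) * \prod_(s < l) (1 + (2 s + 1) X)]. *)

Require Import Defs.
From HB Require Import structures.
From mathcomp Require Import all_boot all_order all_algebra.
From mathcomp Require Import mpoly.
From mathcomp Require Import complex.
From mathcomp Require Import all_classical all_reals all_analysis.
From mathcomp Require Import perm ring lra.
Import Order.TTheory GRing.Theory Num.Theory.
Import numFieldNormedType.Exports.
Local Open Scope ring_scope.

(** * Sums of principal minors as coefficients of [det (1 + X M)] *)

Lemma det_sylvester (T : comNzRingType) (m n : nat) (A : 'M[T]_(m, n)) (B : 'M[T]_(n, m)) :
  \det (1%:M + A *m B) = \det (1%:M + B *m A).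
Proof.
(* Two block triangular factorizations of one matrix; comparing their determinants gives both
   sides. *)
have e1 : block_mx 1%:M (- A) B 1%:M =
  block_mx 1%:M 0 B 1%:M *m block_mx 1%:M (- A) 0 (1%:M + B *m A).
  rewrite mulmx_block !mul1mx !mul0mx !mulmx1 ?mulmx0 ?addr0.
  by have -> : B *m (- A) + (1%:M + B *m A) = 1%:M by rewrite mulmxN addrC addrK.
have e2 : block_mx 1%:M (- A) B 1%:M =
  block_mx 1%:M (- A) 0 1%:M *m block_mx (1%:M + A *m B) 0 B 1%:M.
  by rewrite mulmx_block !mul1mx !mul0mx !mulmx1 ?mulmx0 !add0r mulNmx addrK.
have := congr1 determinant e1; rewrite {1}e2 !det_mulmx !det_ublock !det_lblock.
by rewrite !det1 !mul1r !mulr1.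
Qed.

(** Padding a minor with rows of the identity makes all minors [n x n] determinants, whose Leibniz
    expansions run over the same permutations. *)
Lemma det_principal_minor (T : comNzRingType) (n : nat) (M : 'M[T]_n) (I : {set 'I_n}) :
  \det (mxsub (fun i : 'I_#|I| => enum_val i) (fun i : 'I_#|I| => enum_val i) M) =
  \det (\matrix_(i, j) if i \in I then M i j else (i == j)%:R).
Proof.
pose S : 'M[T]_(#|I|, n) := \matrix_(a, i) (enum_val a == i)%:R.
have Smul (p : nat) (X : 'M[T]_(n, p)) : S *m X = \matrix_(a, j) X (enum_val a) j.
  apply/matrixP=> a j; rewrite !mxE (bigD1 (enum_val a)) //= !mxE eqxx mul1r.
  by rewrite big1 ?addr0 // => i /negbTE ni; rewrite !mxE eq_sym ni mul0r.
have mulS (p : nat) (X : 'M[T]_(p, n)) : X *m S^T = \matrix_(i, a) X i (enum_val a).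
  rewrite -[LHS]trmxK trmx_mul trmxK Smul; by apply/matrixP=> i a; rewrite !mxE.
(* With the row selector [S], [S *m S^T = 1] and [S^T *m S] projects onto [I]. *)
have -> : mxsub (fun i : 'I_#|I| => enum_val i) (fun i : 'I_#|I| => enum_val i) M =
    1%:M + S *m ((M - 1%:M) *m S^T).
  rewrite mulS Smul; apply/matrixP=> a b; rewrite !mxE (inj_eq enum_val_inj).
  by rewrite addrC subrK.
rewrite mulmxA det_sylvester; congr (\det _).
apply/matrixP=> i j; rewrite Smul !mxE.
under eq_bigr do rewrite !mxE.
rewrite -(big_enum_val (fun k => (k == i)%:R * (M k j - (k == j)%:R))) /=.
case: ifP => iI; last first.
  rewrite big1 ?addr0 // => k kI; case: eqP => [ki|_]; last by rewrite mul0r.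
  by rewrite -ki kI in iI.
rewrite (bigD1 i) //= eqxx mul1r big1 ?addr0 1?addrC ?subrK // => k /andP[_ /negbTE ->].
by rewrite mul0r.
Qed.

(** Each Leibniz factor is a sum of two terms; expanding the product chooses the set [I] of rows
    taken from [c *: M]. *)
Lemma det_1DZ (T : comNzRingType) (n : nat) (c : T) (M : 'M[T]_n) :
  \det (1%:M + c *: M) =
  \sum_(I : {set 'I_n}) c ^+ #|I| *
    \det (\matrix_(i, j) if i \in I then M i j else (i == j)%:R).
Proof.
transitivity (\sum_(s : 'S_n) \sum_(I : {set 'I_n}) (-1) ^+ s *
    (c ^+ #|I| * \prod_i (if i \in I then M i (s i) else (i == s i)%:R))).
  apply: eq_bigr => s _; rewrite -big_distrr /=; congr (_ * _).
  under eq_bigr do rewrite !mxE addrC.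
  rewrite bigA_distr; apply: eq_bigr => I _.
  rewrite -prodr_const [X in X * _]big_mkcond -big_split /=.
  by apply: eq_bigr => i _; case: ifP; rewrite ?mul1r.
rewrite exchange_big; apply: eq_bigr => I _; rewrite [in RHS]/determinant big_distrr /=.
apply: eq_bigr => s _; rewrite mulrCA; congr (_ * (_ * _)).
by apply: eq_bigr => i _; rewrite mxE.
Qed.

(** Turns statements about [Sigma] into determinant identities, to which intertwining and block
    triangularity apply. *)
Lemma Sigma_coef (T : comNzRingType) (n k : nat) (M : 'M[T]_n) :
  Sigma k M = (\det (1%:M + 'X *: map_mx polyC M))`_k.
Proof.
rewrite det_1DZ coef_sum /Sigma [LHS]big_mkcond; apply: eq_bigr => I _.
rewrite -det_principal_minor mulrC coefMXn -map_mxsub det_map_mx coefC.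
by rewrite subn_eq0; case: ltngtP.
Qed.

(** * The Cauchy-Vandermonde intertwining *)

Lemma det_1DXZ_intertwine {F : fieldType} {n : nat} (A B C : 'M[F]_n) :
  \det C != 0 -> A *m C = C *m B ->
  \det (1%:M + 'X *: map_mx polyC A) = \det (1%:M + 'X *: map_mx polyC B).
Proof.
move=> C0 AC; have pC0 : \det (map_mx polyC C) != 0 by rewrite det_map_mx polyC_eq0.
apply: (mulIf pC0); rewrite [RHS]mulrC -!det_mulmx mulmxDl mulmxDr mul1mx mulmx1.
by rewrite -scalemxAl -scalemxAr -!map_mxM AC.
Qed.

Definition cauchyVander {F : fieldType} {n l : nat} (u : 'I_(n + l) -> F) (v : 'I_n -> F) :
    'M[F]_(n + l) :=
  row_mx (\matrix_(j, k) (u j - v k)^-1) (\matrix_(j, s) u j ^+ s).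

Lemma det_cauchyVander_neq0 {F : fieldType} {n l : nat} (u : 'I_(n + l) -> F) (v : 'I_n -> F) :
  injective u -> injective v -> (forall j k, u j != v k) ->
  \det (cauchyVander u v) != 0.
Proof.
move=> uI vI uv; rewrite -det_tr; apply/negP => /det0P[w w0 wC].
pose a k : F := w 0 (lshift l k); pose b s : F := w 0 (rshift n s).
have eqn j : \sum_k a k / (u j - v k) + \sum_s b s * u j ^+ s = 0.
  have := congr1 (fun X : 'rV[F]_(n + l) => X 0 j) wC; rewrite !mxE => wCj; rewrite -[RHS]wCj.
  rewrite big_split_ord /=; congr (_ + _); apply: eq_bigr => i _.
    by rewrite !mxE (unsplitK (inl i)) mxE.
  by rewrite !mxE (unsplitK (inr i)) mxE.
(* A kernel vector gives a rational function [p / Q], [size p <= n + l], vanishing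
   at the [n + l] points [u j]. *)
pose Q : {poly F} := \prod_k ('X - (v k)%:P).
pose L k : {poly F} := \prod_(i | i != k) ('X - (v i)%:P).
pose bp : {poly F} := \sum_(s < l) b s *: 'X^s.
pose p : {poly F} := \sum_k a k *: L k + Q * bp.
have QL k : Q = ('X - (v k)%:P) * L k by rewrite /Q (bigD1 k).
have sQ : size Q = n.+1 by rewrite /Q size_prod_XsubC -sum1_size sum1_card card_ord.
have sL k : size (L k) = n.
  have := sQ; rewrite (QL k) size_Mmonic ?monicXsubC ?monic_neq0 ?monic_prod_XsubC //.
    by rewrite size_XsubC => -[].
  exact: monicXsubC.
have p0 : p = 0.
  apply/eqP/negP => /negP p0.
  have /(max_poly_roots p0) : all (root p) [seq u j | j : 'I_(n + l)].
    apply/allP => _ /mapP[j _ ->]; rewrite rootE /p hornerD hornerM horner_sum.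
    have -> : bp.[u j] = \sum_s b s * u j ^+ s.
      by rewrite horner_sum; apply: eq_bigr => s _; rewrite hornerZ hornerXn.
    have -> : \sum_i (a i *: L i).[u j] = Q.[u j] * \sum_k a k / (u j - v k).
      rewrite mulr_sumr; apply: eq_bigr => k _.
      have uvk : u j - v k != 0 by rewrite subr_eq0.
      by rewrite hornerZ (QL k) hornerM hornerXsubC; field.
    by rewrite -mulrDr eqn mulr0.
  rewrite map_inj_uniq // => /(_ (enum_uniq _)); rewrite size_map -cardE card_ord.
  apply/negP; rewrite -leqNgt (leq_trans (size_polyD _ _)) // geq_max; apply/andP; split.
    rewrite (leq_trans (size_sum _ _ _)) //; apply/bigmax_leqP => k _.
    by rewrite (leq_trans (size_scale_leq _ _)) // sL leq_addr.
  rewrite (leq_trans (size_polyMleq _ _)) // sQ /= leq_add2l.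
  rewrite (leq_trans (size_sum _ _ _)) //; apply/bigmax_leqP => s _.
  by rewrite (leq_trans (size_scale_leq _ _)) // size_polyXn.
(* At [v k] every term of [p] except [a k *: L k] vanishes, and [L k] is nonzero there. *)
have a0 k : a k = 0.
  have := congr1 (horner^~ (v k)) p0; rewrite /= /p hornerD hornerM (QL k) hornerM.
  rewrite hornerXsubC subrr !mul0r addr0 horner_sum horner0 (bigD1 k) //= big1 ?addr0.
    move/eqP; rewrite hornerZ mulf_eq0 => /orP[/eqP //|].
    rewrite horner_prod => /prodf_eq0[i ik].
    by rewrite hornerXsubC subr_eq0 => /eqP/vI ki; rewrite ki eqxx in ik.
  move=> i ik; rewrite hornerZ /L (bigD1 k) 1?eq_sym //= hornerM hornerXsubC.
  by rewrite subrr mul0r mulr0.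
have bp0 : bp = 0.
  apply/eqP; move/eqP: p0; rewrite /p big1 ?add0r; last by move=> k _; rewrite a0 scale0r.
  by rewrite mulf_eq0 -(size_poly_eq0 Q) sQ.
have b0 s : b s = 0.
  have := congr1 (fun q : {poly F} => q`_s) bp0; rewrite coef0 coef_sum => bps; rewrite -[RHS]bps.
  rewrite (bigD1 s) //= coefZ coefXn eqxx mulr1 big1 ?addr0 // => i /negbTE ne.
  by rewrite coefZ coefXn eq_sym (inj_eq val_inj) ne mulr0.
case/eqP: w0; apply/rowP => i; rewrite mxE; case: (split_ordP i) => k ->.
  exact: a0.
exact: b0.
Qed.

(** In the variables [u], [v] a tanh is [1 + 2 v_i / (u_j - v_i)] and a coth is
    [1 + 2 u_i / (u_j - u_i)], so for [m = n + l] the constant on the diagonal is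
    [l + n - (n + l - 1) = 1]. Likewise [l - (n + l) + (n - 1) = - 1] in [cauchyB]. *)
Definition cauchyA {F : fieldType} {m n : nat} (u : 'I_m -> F) (v : 'I_n -> F) : 'M[F]_m :=
  \matrix_(j, k) if j == k
    then 1 + 2 * \sum_i v i / (u j - v i) - 2 * \sum_(i | i != j) u i / (u j - u i)
    else 2 * u k / (u j - u k).

Definition cauchyB {F : fieldType} {m n : nat} (u : 'I_m -> F) (v : 'I_n -> F) : 'M[F]_n :=
  \matrix_(k, j) if k == j
    then - 1 + 2 * \sum_i u i / (u i - v j) - 2 * \sum_(i | i != j) v i / (v i - v j)
    else 2 * v k / (v k - v j).

(* The action of [cauchyA u v] on the columns [u_j ^ s], modulo the Cauchy columns. *)
Definition vanderT {F : fieldType} {m n : nat} (u : 'I_m -> F) (v : 'I_n -> F) (l : nat) :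
    'M[F]_l :=
  \matrix_(i, s) if i == s then (2 * s + 1)%:R
    else if (i < s)%N then 2 * (\sum_k v k ^+ (s - i) - \sum_k u k ^+ (s - i)) else 0.

(** Partial fractions cancel the differences within [u] and within [v], leaving both sides over
    [u j - v p]. The numerators then agree because [2 + 2 v_p / (u_j - v_p) = 2 u_j / (u_j -
    v_p)]. *)
Lemma cauchy_intertwine {F : fieldType} {m n : nat} (u : 'I_m -> F) (v : 'I_n -> F) :
  injective u -> injective v -> (forall j k, u j != v k) ->
  let C : 'M[F]_(m, n) := \matrix_(j, k) (u j - v k)^-1 in
  cauchyA u v *m C = C *m cauchyB u v.
Proof.
move=> uI vI uv C; apply/matrixP => j p; rewrite !mxE.
have uv0 i k : u i - v k != 0 by rewrite subr_eq0.
have cup := uv0 j p.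
have -> : \sum_k cauchyA u v j k * C k p =
    (1 + 2 * \sum_i v i / (u j - v i) + 2 * \sum_(i | i != j) u i / (u i - v p)) / (u j - v p).
  rewrite (bigD1 j) //= !mxE eqxx mulrDl mulNr -addrA [RHS]mulrDl; congr (_ + _).
  rewrite addrC -!mulrA !mulr_suml !mulr_sumr -sumrB; apply: eq_bigr => k kj.
  have ujk : u j - u k != 0 by rewrite subr_eq0 (inj_eq uI) eq_sym.
  rewrite !mxE eq_sym (negbTE kj); field; by rewrite ujk cup uv0.
have -> : \sum_k C j k * cauchyB u v k p =
    (- 1 + 2 * \sum_i u i / (u i - v p) + 2 * \sum_(i | i != p) v i / (u j - v i)) / (u j - v p).
  rewrite (bigD1 p) //= !mxE eqxx mulrC mulrDl mulNr -addrA [RHS]mulrDl; congr (_ + _).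
  rewrite addrC -!mulrA !mulr_suml !mulr_sumr -sumrB; apply: eq_bigr => k kp.
  have vkp : v k - v p != 0 by rewrite subr_eq0 (inj_eq vI).
  rewrite !mxE (negbTE kp); field; by rewrite vkp cup uv0.
rewrite (bigD1 p) //= [X in _ = (_ + 2 * X + _) / _](bigD1 j) //=.
move: (\sum_(i | _) _) (\sum_(i | _) _) => a b; field; exact: cup.
Qed.

Lemma divX_subXX {F : fieldType} (x y : F) (n : nat) :
  x - y != 0 -> (x ^+ n - y ^+ n) / (x - y) = \sum_(i < n) y ^+ (n.-1 - i) * x ^+ i.
Proof.
move=> xy; have yx : y - x != 0 by rewrite -opprB oppr_eq0.
by rewrite -opprB subrXX -(opprB y x) invrN mulrNN mulrC mulKf.
Qed.

(** The diagonal and off-diagonal terms in [u] combine into divided differences of [X ^ s], which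
    are polynomials in [u j]; only the terms in [v] leave poles, and these are Cauchy columns. *)
Lemma vander_intertwine {F : fieldType} {m n : nat} (l : nat) (u : 'I_m -> F) (v : 'I_n -> F) :
  injective u -> (forall j k, u j != v k) ->
  let V : 'M[F]_(m, l) := \matrix_(j, s) u j ^+ s in
  cauchyA u v *m V = (\matrix_(j, k) (u j - v k)^-1) *m (\matrix_(k, s) (2 * v k ^+ s.+1)) +
    V *m vanderT u v l.
Proof.
move=> uI uv V; apply/matrixP => j s; rewrite !mxE.
have uv0 i k : u i - v k != 0 by rewrite subr_eq0.
pose q e := \sum_k v k ^+ e; pose p e := \sum_k u k ^+ e.
have -> : \sum_k V j k * vanderT u v l k s =
    (2 * s + 1)%:R * u j ^+ s + \sum_(i < s) 2 * (q (s - i)%N - p (s - i)%N) * u j ^+ i.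
  rewrite (bigD1 s) //= !mxE eqxx mulrC; congr (_ + _).
  rewrite (big_ord_widen_cond l xpredT (fun i => 2 * (q (s - i)%N - p (s - i)%N) * u j ^+ i)) /=;
    last by rewrite ltnW.
  rewrite [LHS](bigID (fun i : 'I_l => (i < s)%N)) /= addrC big1 ?add0r; last first.
    by move=> i /andP[/negbTE ns /negbTE lt]; rewrite !mxE ns lt mulr0.
  apply: eq_big => i; first by rewrite andb_idl // => /ltn_eqF; rewrite -(inj_eq val_inj) /= => ->.
  by move=> /andP[/negbTE ns lt]; rewrite !mxE ns lt mulrC.
have -> : \sum_k cauchyA u v j k * V k s =
    u j ^+ s + 2 * \sum_i (v i / (u j - v i) * u j ^+ s)
    - \sum_(k | k != j) 2 * u k * ((u j ^+ s - u k ^+ s) / (u j - u k)).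
  rewrite (bigD1 j) //= !mxE eqxx mulrBl mulrDl mul1r -!addrA; congr (_ + _).
  rewrite -[2 * _ * _]mulrA mulr_suml; congr (_ + _).
  rewrite -mulrA mulr_suml mulr_sumr addrC -!sumrB -[RHS]sumrN; apply: eq_bigr => k kj.
  have ujk : u j - u k != 0 by rewrite subr_eq0 (inj_eq uI) eq_sym.
  by rewrite !mxE eq_sym (negbTE kj); field.
(* The sum omits [k = j]. Completing it to power sums costs [2 * u j ^+ s] for each of the [s]
   exponents, which is the source of [2 s] in the eigenvalue [2 s + 1]. *)
have -> : \sum_(k | k != j) 2 * u k * ((u j ^+ s - u k ^+ s) / (u j - u k)) =
   \sum_(i < s) 2 * p (s - i)%N * u j ^+ i - (2 * s)%:R * u j ^+ s.
  transitivity (\sum_(k | k != j) \sum_(i < s) 2 * u k ^+ (s - i) * u j ^+ i).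
    apply: eq_bigr => k kj.
    have ujk : u j - u k != 0 by rewrite subr_eq0 (inj_eq uI) eq_sym.
    rewrite divX_subXX // mulr_sumr; apply: eq_bigr => i _.
    by rewrite -mulrA [u k * _]mulrA -exprS -predn_sub prednK ?subn_gt0 // mulrA.
  have -> : (2 * s)%:R * u j ^+ s = \sum_(i < s) 2 * u j ^+ (s - i) * u j ^+ i.
    rewrite (eq_bigr (fun=> 2 * u j ^+ s)).
      by rewrite sumr_const card_ord natrM -[RHS]mulr_natl; ring.
    by move=> i _; rewrite -mulrA -exprD subnK // ltnW.
  rewrite exchange_big -sumrB; apply: eq_bigr => i _.
  rewrite /p [in RHS](bigD1 j) //= mulrDr mulrDl addrC addKr.
  by rewrite mulr_sumr mulr_suml.
(* Dividing [u j ^+ s] by [u j - v i] leaves the remainder [v i ^+ s], hence the Cauchy columns with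
   coefficients [v i ^+ s.+1]. *)
have -> : \sum_i (v i / (u j - v i) * u j ^+ s) =
   \sum_i (u j - v i)^-1 * v i ^+ s.+1 + \sum_(i < s) q (s - i)%N * u j ^+ i.
  have -> : \sum_(i < s) q (s - i)%N * u j ^+ i = \sum_k \sum_(i < s) v k ^+ (s - i) * u j ^+ i.
    by rewrite exchange_big; apply: eq_bigr => i _; rewrite mulr_suml.
  rewrite -big_split; apply: eq_bigr => k _ /=.
  have -> : \sum_(i < s) v k ^+ (s - i) * u j ^+ i = v k * ((u j ^+ s - v k ^+ s) / (u j - v k)).
    rewrite divX_subXX // mulr_sumr; apply: eq_bigr => i _.
    by rewrite mulrA -exprS -predn_sub prednK ?subn_gt0.
  by rewrite exprS; field.
rewrite [X in _ = X + _](eq_bigr (fun i => 2 * ((u j - v i)^-1 * v i ^+ s.+1))); last first.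
  by move=> i _; rewrite !mxE mulrCA.
have -> : \sum_(i < s) 2 * (q (s - i)%N - p (s - i)%N) * u j ^+ i =
   2 * (\sum_(i < s) q (s - i)%N * u j ^+ i) - \sum_(i < s) 2 * p (s - i)%N * u j ^+ i.
  by rewrite mulr_sumr -sumrB; apply: eq_bigr => i _; ring.
rewrite -mulr_sumr natrD; ring.
Qed.

Lemma det_1DXZ_cauchy {F : fieldType} {n l : nat} (u : 'I_(n + l) -> F) (v : 'I_n -> F) :
  injective u -> injective v -> (forall j k, u j != v k) ->
  \det (1%:M + 'X *: map_mx polyC (cauchyA u v)) =
  \prod_(s < l) (1 + (2 * s + 1)%:R *: 'X) * \det (1%:M + 'X *: map_mx polyC (cauchyB u v)).
Proof.
move=> uI vI uv.
pose X : 'M[F]_(n, l) := \matrix_(k, s) (2 * v k ^+ s.+1).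
(* [cauchyVander] conjugates [cauchyA] to a block upper triangular matrix with diagonal blocks
   [cauchyB] and [vanderT]. *)
rewrite (det_1DXZ_intertwine _ (block_mx (cauchyB u v) X 0 (vanderT u v l)) _
  (det_cauchyVander_neq0 u v uI vI uv)); last first.
  rewrite /cauchyVander mul_mx_row mul_row_block mulmx0 addr0.
  by rewrite cauchy_intertwine // vander_intertwine.
rewrite map_block_mx scale_block_mx (scalar_mx_block n l) add_block_mx map_mx0 scaler0 addr0.
(* [vanderT] is upper triangular while [is_trig_mx] means lower triangular, hence the
   transposition. *)
rewrite det_ublock mulrC; congr (_ * _); rewrite -det_tr det_trig.
  by apply: eq_bigr => s _; rewrite !mxE eqxx mulrC mul_polyC.
apply/is_trig_mxP => i s lis; rewrite !mxE.
have /negbTE -> : s != i by rewrite -(inj_eq val_inj) gtn_eqF.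
by rewrite ltnNge ltnW //= polyC0 mulr0 addr0.
Qed.

Lemma coef_prod_1DZX (R : realType) (l j : nat) :
  (\prod_(s < l) (1 + (2 * s + 1)%:R *: 'X) : {poly R})`_j = esymOdd R l j.
Proof.
under eq_bigr do rewrite addrC.
rewrite bigA_distr coef_sum /esymOdd [RHS]big_mkcond; apply: eq_bigr => J _.
rewrite -big_mkcond /=.
under eq_bigr do rewrite -mul_polyC.
rewrite big_split prodr_const -(rmorph_prod (@polyC R)) /= mul_polyC coefZ coefXn /= eq_sym.
by case: eqP; rewrite ?mulr1 ?mulr0.
Qed.

(** The Cauchy product of coefficients, cut at [l] because ['I_l] has no subset with more than [l]
    elements. For [k - j > n] the [Sigma] on the right is an empty sum, in agreement with the
    convention of the theorem. *)
Lemma Sigma_cauchy (R : realType) (n l k : nat) (u : 'I_(n + l) -> R) (v : 'I_n -> R) :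
  injective u -> injective v -> (forall j k, u j != v k) ->
  Sigma k (cauchyA u v) =
  \sum_(0 <= j < (minn k l).+1) esymOdd R l j * Sigma (k - j) (cauchyB u v).
Proof.
move=> uI vI uv; rewrite Sigma_coef det_1DXZ_cauchy // coefM.
under eq_bigr do rewrite coef_prod_1DZX -Sigma_coef.
rewrite -(big_mkord xpredT (fun j => esymOdd R l j * Sigma (k - j) (cauchyB u v))).
rewrite (big_cat_nat (n := (minn k l).+1)) //=; last by rewrite ltnS geq_minl.
rewrite [X in _ + X](_ : _ = 0) ?addr0 // big_nat big1 // => j /andP[lj jk].
rewrite /esymOdd big_pred0 ?mul0r // => J; apply/negbTE.
have lj' : (l < j)%N by move: lj; rewrite gtn_min ltnNge -ltnS jk.
by rewrite neq_ltn (leq_ltn_trans (max_card _)) ?card_ord.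
Qed.

(** * Behaviour of [Sigma] under gauge, transposition, morphisms and scaling *)

Lemma Sigma_conj (F : fieldType) (n k : nat) (A B : 'M[F]_n) (s : 'I_n -> F) :
  (forall i, s i != 0) -> (forall i j, A i j * s j = s i * B i j) -> Sigma k A = Sigma k B.
Proof.
move=> s0 AB; rewrite !Sigma_coef; rewrite (det_1DXZ_intertwine _ B (diag_mx (\row_i s i))) //.
  by rewrite det_diag; apply/prodf_neq0 => i _; rewrite mxE.
rewrite mul_mx_diag mul_diag_mx; apply/matrixP => i j; rewrite !mxE; exact: AB.
Qed.

Lemma Sigma_tr (T : comNzRingType) (n k : nat) (M : 'M[T]_n) : Sigma k M^T = Sigma k M.
Proof. by rewrite !Sigma_coef -[in RHS]det_tr linearD linearZ /= trmx1 map_trmx. Qed.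

Lemma Sigma_map (S T : comNzRingType) (f : {rmorphism S -> T}) (n k : nat) (M : 'M[S]_n) :
  Sigma k (map_mx f M) = f (Sigma k M).
Proof.
rewrite /Sigma rmorph_sum; apply: eq_bigr => I _.
by rewrite -map_mxsub det_map_mx.
Qed.

Lemma SigmaZ (T : comNzRingType) (n k : nat) (c : T) (M : 'M[T]_n) :
  Sigma k (c *: M) = c ^+ k * Sigma k M.
Proof.
rewrite /Sigma big_distrr; apply: eq_bigr => I /eqP <- /=.
by rewrite -detZ; congr (\det _); apply/matrixP => i j; rewrite !mxE.
Qed.

(** * Partial derivatives of products of one-variable functions *)

Definition tanhR {R : realType} (t : R) : R := sinhR t / coshR t.

Lemma coshR_gt0 {R : realType} (t : R) : 0 < coshR t.
Proof. by rewrite divr_gt0 // addr_gt0 ?expR_gt0. Qed.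

Lemma is_derive_ln_coshR {R : realType} (t : R) :
  is_derive t 1 (fun s : R => @ln R (2 * coshR s)) (tanhR t).
Proof.
have -> : (fun s : R => @ln R (2 * coshR s)) = @ln R \o (expR + (expR \o -%R)).
  by apply/funext => s /=; congr (@ln R _); rewrite /coshR mulrC divfK.
have t0 : 0 < (expR + (expR \o -%R)) t by rewrite addr_gt0 ?expR_gt0.
have dN : is_derive t 1 (fun s : R => - s) (- 1) by exact: is_deriveN.
have dE : is_derive t 1 (expR \o -%R) (expR (- t) * - 1) by exact: is_derive1_comp.
have dS : is_derive t 1 (expR + (expR \o -%R)) (expR t + expR (- t) * - 1) by exact: is_deriveD.
have dl := is_derive1_ln t0.
apply: (is_derive_eq (is_derive1_comp dl dS)).
have p0 : expR t + expR (- t) != 0 by rewrite gt_eqF.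
change ((expR t + expR (- t))^-1 * (expR t + expR (- t) * - 1) = tanhR t).
by rewrite /tanhR /sinhR /coshR; field.
Qed.

(** Along [delta_mx 0 i] only the factor [F i] varies, so the difference quotient is a constant
    times that of [F i]. *)
Lemma derive_prod_coord {R : realType} {n : nat} (c : R) (F : 'I_n -> R -> R)
    (i : 'I_n) (a : 'rV[R]_n) :
  derivable (F i) (a 0 i) 1 ->
  'D_(delta_mx 0 i) (fun x : 'rV[R]_n => c * \prod_k F k (x 0 k)) a =
  c * \prod_k (if k == i then (F k)^`()%classic else F k) (a 0 k).
Proof.
move=> dF; rewrite /derive.
pose G := c * \prod_(k | k != i) F k (a 0 k).
have -> : (fun h : R => h^-1 *: (((fun x : 'rV[R]_n => c * \prod_k F k (x 0 k)) \o shift a)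
      (h *: delta_mx 0 i) - c * \prod_k F k (a 0 k))) =
    (fun h => G * (h^-1 *: ((F i \o shift (a 0 i)) (h *: 1) - F i (a 0 i)))).
  apply/funext => h /=.
  rewrite (bigD1 i) //= [X in _ - c * X](bigD1 i) //= !mxE !eqxx /=.
  rewrite (eq_bigr (fun k => F k (a 0 k))); last first.
    by move=> k /negbTE ki; rewrite !mxE ki andbF mulr0 add0r.
  by rewrite /G /GRing.scale /=; ring.
rewrite (bigD1 i) //= eqxx mulrCA mulrC.
rewrite (eq_bigr (fun k => F k (a 0 k))); last by move=> k /negbTE ->.
rewrite derive1E -/G; apply: cvg_lim => //; by apply: cvgMl_tmp; exact: dF.
Qed.

Lemma dmulti_prod {R : realType} {n : nat} (c : R) (F : 'I_n -> R -> R) (m : 'X_{1..n}) :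
  (forall k t, derivable (F k) t 1) -> (forall k, (m k <= 1)%N) ->
  dmulti m (fun x : 'rV[R]_n => c * \prod_k F k (x 0 k)) =
  fun x => c * \prod_k (if m k == 1%N then (F k)^`()%classic else F k) (x 0 k).
Proof.
move=> dF m1; rewrite /dmulti.
(* Induction on the variables already treated; [uniq] ensures that [F i] is still undifferentiated
   when the turn of [i] comes. *)
have : forall s : seq 'I_n, uniq s ->
    foldr (fun i h => dpow i (m i) h) (fun x : 'rV[R]_n => c * \prod_k F k (x 0 k)) s =
    fun x => c * \prod_k (if (k \in s) && (m k == 1%N) then (F k)^`()%classic else F k) (x 0 k).
  elim=> [_|i s IH /= /andP[si us]]; first by apply/funext => x.
  rewrite IH // /dpow; have := m1 i; case Em: (m i) => [|[|//]] _ /=; apply/funext => x.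
    congr (_ * _); apply: eq_bigr => k _; rewrite in_cons; case: (k =P i) => [->|//].
    by rewrite Em !andbF.
  rewrite (@derive_prod_coord R n c
    (fun k => if (k \in s) && (m k == 1%N) then (F k)^`()%classic else F k)).
    congr (_ * _); apply: eq_bigr => k _; rewrite in_cons; case: (k =P i) => [->|//].
    by rewrite (negbTE si) Em.
  by rewrite (negbTE si); exact: dF.
move=> /(_ _ (enum_uniq 'I_n)) ->; apply/funext => x; congr (_ * _).
by apply: eq_bigr => k _; rewrite mem_enum.
Qed.

(** With exponents at most 1 no second derivative of [e] arises, so a monomial in the derivatives
    acts as the same monomial in the logarithmic derivatives. *)
Lemma dmulti_prod_expR {R : realType} {n : nat} (c : R) (e e' : 'I_n -> R -> R)
    (m : 'X_{1..n}) (x : 'rV[R]_n) :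
  (forall (k : 'I_n) (t : R), is_derive t 1 (e k) (e' k t)) -> (forall k, (m k <= 1)%N) ->
  dmulti m (fun x : 'rV[R]_n => c * \prod_k expR (e k (x 0 k))) x =
  (\prod_k e' k (x 0 k) ^+ m k) * (c * \prod_k expR (e k (x 0 k))).
Proof.
move=> de m1.
have dF (k : 'I_n) (t : R) : is_derive t 1 (expR \o e k) (expR (e k t) * e' k t) by exact: is_derive1_comp.
rewrite (@dmulti_prod R n c (fun k => expR \o e k)) // mulrCA; congr (_ * _).
rewrite -big_split; apply: eq_bigr => k _ /=.
have := m1 k; case: (m k) => [|[|//]] _ /=; first by rewrite expr0 mul1r.
by rewrite derive1E derive_val mulrC.
Qed.

(** * Squarefree momenta: the normal-ordered operator as a multiplication *)

Lemma scale_mpolyX_prod (T : comNzRingType) (n : nat) (I : finType) (c : I -> T)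
    (m : I -> 'X_{1..n}) :
  \prod_i (c i *: 'X_[m i] : {mpoly T[n]}) = (\prod_i c i) *: 'X_[\sum_i m i].
Proof.
elim/big_rec3: _ => [|i p a q _ ->]; first by rewrite scale1r mpolyX0.
by rewrite mpolyXD -scalerAl -scalerAr scalerA.
Qed.

Lemma mcoeff_prod_affine (T : comNzRingType) (n : nat) (a b : 'I_n -> T) (m : 'X_{1..n}) (i : 'I_n) :
  (1 < m i)%N -> (\prod_j (a j *: 'X_j + (b j)%:MP) : {mpoly T[n]})@_m = 0.
Proof.
move=> mi; rewrite bigA_distr raddf_sum big1 // => J _ /=.
rewrite (eq_bigr (fun j => (if j \in J then a j else b j) *:
    'X_[if j \in J then U_(j)%MM else 0%MM])); last first.
  by move=> j _; case: ifP => // _; rewrite mpolyX0 alg_mpolyC.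
rewrite scale_mpolyX_prod mcoeffZ mcoeffX; case: eqP => [E|_]; last by rewrite mulr0.
move: mi; rewrite -E mnm_sumE (bigD1 i) //= big1.
  by case: ifP => _; rewrite ?mnm1E ?eqxx ?mnm0E.
by move=> j /negbTE ji; case: ifP => _; rewrite ?mnm1E ?ji ?mnm0E.
Qed.

(** The momentum ['X_j] occurs only in the entry [(j, j)], so every Leibniz term is a product of
    factors, the [j]-th of which is affine in ['X_j] alone. *)
Lemma msupp_SigmaPoly {R : realType} (mu g : R) (n k : nat) (x : 'rV[R]_n) (m : 'X_{1..n}) :
  m \in msupp (SigmaPoly mu g k x) -> forall i, (m i <= 1)%N.
Proof.
rewrite mcoeff_msupp => m0 i; rewrite leqNgt; apply: contra m0 => mi.
rewrite /SigmaPoly /Sigma raddf_sum big1 // => I _ /=.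
rewrite det_principal_minor raddf_sum big1 // => s _ /=.
suff -> : \prod_j (\matrix_(i0, j0) if i0 \in I then LnrE mu g x i0 j0 else (i0 == j0)%:R) j (s j) =
    \prod_j (((j \in I) && (j == s j))%:R *: 'X_j +
      (if j \in I then if j == s j then zE mu g x j else
         (('i * (mu * g)%:C / (2 * sinhR (mu * (x 0 j - x 0 (s j)) / 2))%:C)%C)
       else (j == s j)%:R)%:MP).
  by rewrite mulr_sign; case: (odd_perm s); rewrite ?mcoeffN (mcoeff_prod_affine _ _ _ _ _ i) ?oppr0.
apply: eq_bigr => j _; rewrite !mxE; case: ifP => _ /=; last by rewrite scale0r add0r; case: eqP.
by case: eqP => _ /=; rewrite ?scale1r ?scale0r ?add0r.
Qed.

(** The point [z] of the coefficients is kept apart from the point [x] of the function, and [kap] is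
    free, so that both operators are covered: [z = x] with [kap = - i hb], and [z = - y] with
    [kap = i hb]. *)
Lemma sum_SigmaPoly_expR {R : realType} (mu g : R) (n k : nat) (z x : 'rV[R]_n) (kap : R[i])
    (f : 'rV[R]_n -> R) (c : R) (e e' : 'I_n -> R -> R) :
  (forall (k : 'I_n) (t : R), is_derive t 1 (e k) (e' k t)) ->
  f = (fun x => c * \prod_k expR (e k (x 0 k))) ->
  \sum_(m <- msupp (SigmaPoly mu g k z))
     (SigmaPoly mu g k z)@_m * kap ^+ mdeg m * (dmulti m f x)%:C%C =
  Sigma k (map_mx (meval (fun i => kap * (e' i (x 0 i))%:C%C)) (LnrE mu g z)) * (f x)%:C%C.
Proof.
move=> de fE; rewrite Sigma_map /= -/(SigmaPoly mu g k z) mevalE mulr_suml.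
apply: eq_big_seq => m /msupp_SigmaPoly m1.
have fx : f x = c * \prod_k expR (e k (x 0 k)) by rewrite fE.
rewrite [in LHS]fE (dmulti_prod_expR _ _ _ _ _ de) // -fx rmorphM /= mulrA -!mulrA.
congr (_ * _); rewrite !mulrA; congr (_ * _).
rewrite mdegE -prodrXr rmorph_prod -big_split; apply: eq_bigr => i _ /=.
by rewrite exprMn rmorphXn.
Qed.

(* [L_nr + E] at [z], divided by [i mu g / 2], with [d] in place of the momenta. *)
Definition laxR {R : realType} (mu : R) (n : nat) (z : 'rV[R]_n) (d : 'I_n -> R) : 'M[R]_n :=
  \matrix_(j, k) if j == k
    then d j - \sum_(i | i != j) cothR (mu * (z 0 j - z 0 i) / 2)
    else (sinhR (mu * (z 0 j - z 0 k) / 2))^-1.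

Lemma map_LnrE {R : realType} (mu g : R) (n : nat) (z : 'rV[R]_n) (w : 'I_n -> R[i])
    (d : 'I_n -> R) :
  let be : R[i] := ('i * (mu * g / 2)%:C)%C in
  (forall i, w i = be * (d i)%:C%C) ->
  map_mx (meval w) (LnrE mu g z) = be *: map_mx (real_complex R) (laxR mu n z d).
Proof.
move=> be wE; apply/matrixP => j k; rewrite !mxE; case: eqP => [_|_].
  rewrite mevalD mevalX mevalC /zE -/be mulNr.
  rewrite (bigD1 j) //= big1 => [|i /negbTE ij]; last by rewrite mnm1E eq_sym ij.
  by rewrite mnm1E eqxx mulr1 expr1 wE rmorphB rmorph_sum mulrBr.
rewrite mevalC /be -!mulrA; congr (_ * _).
rewrite -fmorphV -!rmorphM /=; congr (_%:C)%C.
by rewrite invfM; ring.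
Qed.

(** * The kernel as a product of one-variable exponentials *)

Lemma is_derive_sum_ln_coshR {R : realType} (n : nat) (a b c t : R) (d : 'I_n -> R) :
  is_derive t 1 (fun s : R => a * s + b * \sum_i @ln R (2 * coshR (c * s + d i)))
    (a + b * c * \sum_i tanhR (c * t + d i)).
Proof.
have daff (p q : R) : is_derive t 1 (fun s : R => p * s + q) p.
  have -> : (fun s : R => p * s + q) = p \*: id + cst q by apply/funext => s.
  apply: is_derive_eq; by rewrite addr0 /GRing.scale /= mulr1.
have dh (i : 'I_n) : is_derive t 1 (fun s : R => @ln R (2 * coshR (c * s + d i)))
    (tanhR (c * t + d i) * c).
  exact: (is_derive1_comp (is_derive_ln_coshR _) (daff c (d i))).
have -> : (fun s : R => a * s + b * \sum_i @ln R (2 * coshR (c * s + d i))) =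
   (fun s : R => a * s + 0) + b \*: \sum_i (fun s : R => @ln R (2 * coshR (c * s + d i))).
  by apply/funext => s; rewrite [RHS]/= fctE /= addr0 /GRing.scale /= fct_sumE.
have dS := is_derive_sum dh.
apply: (is_derive_eq (is_deriveD (daff a 0) (is_deriveZ b dS))).
rewrite /GRing.scale /= -mulr_suml -mulrA; congr (_ + b * _); by rewrite mulrC.
Qed.

Lemma KernE {R : realType} (hb mu g : R) (N l : nat) (x : 'rV[R]_N) (y : 'rV[R]_(N - l)) :
  Kern hb mu g x y =
  expR (mu * g * l%:R / (2 * hb) * (\sum_n y 0 n - \sum_m x 0 m)
    - g / hb * \sum_m \sum_n @ln R (2 * coshR (mu * (x 0 m - y 0 n) / 2))).
Proof.
rewrite /Kern expRB; congr (_ / _).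
rewrite mulr_sumr expR_sum; apply: eq_bigr => m _.
rewrite mulr_sumr expR_sum; apply: eq_bigr => n _.
by rewrite /powR gt_eqF // mulr_gt0 // coshR_gt0.
Qed.

Lemma Kern_xE {R : realType} (hb mu g : R) (N l : nat) (y : 'rV[R]_(N - l)) :
  let A := mu * g * l%:R / (2 * hb) in
  (fun x : 'rV[R]_N => Kern hb mu g x y) =
  fun x => expR (A * \sum_n y 0 n) * \prod_m expR ((- A) * x 0 m +
    (- (g / hb)) * \sum_n @ln R (2 * coshR (mu / 2 * x 0 m + (- (mu / 2 * y 0 n))))).
Proof.
move=> A; apply/funext => x; rewrite KernE -/A -expR_sum -expRD; congr expR.
rewrite big_split /= -!mulr_sumr.
have -> : \sum_m \sum_n ln (2 * coshR (mu * (x 0 m - y 0 n) / 2)) =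
  \sum_m \sum_n ln (2 * coshR (mu / 2 * x 0 m + (- (mu / 2 * y 0 n)))).
  by apply: eq_bigr => m _; apply: eq_bigr => n _; congr (ln (2 * coshR _)); ring.
ring.
Qed.

Lemma Kern_yE {R : realType} (hb mu g : R) (N l : nat) (x : 'rV[R]_N) :
  let A := mu * g * l%:R / (2 * hb) in
  (fun y : 'rV[R]_(N - l) => Kern hb mu g x y) =
  fun y => expR (- A * \sum_m x 0 m) * \prod_n expR (A * y 0 n +
    (- (g / hb)) * \sum_m @ln R (2 * coshR ((- (mu / 2)) * y 0 n + (mu / 2 * x 0 m)))).
Proof.
move=> A; apply/funext => y; rewrite KernE -/A -expR_sum -expRD; congr expR.
rewrite big_split /= -!mulr_sumr exchange_big /=.
have -> : \sum_n \sum_m ln (2 * coshR (mu * (x 0 m - y 0 n) / 2)) =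
  \sum_n \sum_m ln (2 * coshR ((- (mu / 2)) * y 0 n + (mu / 2 * x 0 m))).
  by apply: eq_bigr => m _; apply: eq_bigr => n _; congr (ln (2 * coshR _)); ring.
ring.
Qed.

(** * Passage from hyperbolic to rational matrices *)

Lemma expR_half_diff {R : realType} (mu a b : R) :
  expR (mu * (a - b) / 2) = expR (mu * a / 2) / expR (mu * b / 2).
Proof. by rewrite -expRB; congr expR; ring. Qed.

Lemma expR_half_diffN {R : realType} (mu a b : R) :
  expR (- (mu * (a - b) / 2)) = expR (mu * b / 2) / expR (mu * a / 2).
Proof. by rewrite -expRB; congr expR; ring. Qed.

Lemma tanhR_expR {R : realType} (mu a b : R) :
  let p := expR (mu * a / 2) in let q := expR (mu * b / 2) in
  tanhR (mu * (a - b) / 2) = (p ^+ 2 - q ^+ 2) / (p ^+ 2 + q ^+ 2).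
Proof.
move=> p q; have p0 : 0 < p := expR_gt0 _; have q0 : 0 < q := expR_gt0 _.
have s0 : p ^+ 2 + q ^+ 2 != 0 by rewrite gt_eqF // addr_gt0 // exprn_gt0.
rewrite /tanhR /sinhR /coshR expR_half_diff expR_half_diffN -/p -/q; field.
by rewrite s0 !gt_eqF.
Qed.

Lemma sinhRV_expR {R : realType} (mu a b : R) :
  let p := expR (mu * a / 2) in let q := expR (mu * b / 2) in
  p ^+ 2 - q ^+ 2 != 0 -> (sinhR (mu * (a - b) / 2))^-1 = 2 * p * q / (p ^+ 2 - q ^+ 2).
Proof.
move=> p q pq; have p0 : 0 < p := expR_gt0 _; have q0 : 0 < q := expR_gt0 _.
rewrite /sinhR expR_half_diff expR_half_diffN -/p -/q; field.
by rewrite pq !gt_eqF.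
Qed.

Lemma cothR_expR {R : realType} (mu a b : R) :
  let p := expR (mu * a / 2) in let q := expR (mu * b / 2) in
  p ^+ 2 - q ^+ 2 != 0 -> cothR (mu * (a - b) / 2) = (p ^+ 2 + q ^+ 2) / (p ^+ 2 - q ^+ 2).
Proof.
move=> p q pq; have p0 : 0 < p := expR_gt0 _; have q0 : 0 < q := expR_gt0 _.
rewrite /cothR /sinhR /coshR expR_half_diff expR_half_diffN -/p -/q; field.
by rewrite pq !gt_eqF.
Qed.

Lemma sum1_ord (T : nzRingType) (n : nat) : \sum_(i < n) (1 : T) = n%:R.
Proof. by rewrite sumr_const card_ord. Qed.

Lemma sum1_neq (T : nzRingType) (n : nat) (j : 'I_n) : \sum_(i | i != j) (1 : T) = n%:R - 1.
Proof.
by rewrite -sum1_ord [in RHS](bigD1 j) //= addrC addrK.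
Qed.

(** [N = n + l] is an equation so that [n := N - l] can be taken with no cast of index types: after
    substitution the completed Cauchy matrix is square. *)
Lemma Sigma_laxR {R : realType} (mu : R) (N n l k : nat) (x : 'rV[R]_N) (y : 'rV[R]_n) :
  0 < mu -> N = (n + l)%N ->
  (forall i j : 'I_N, i != j -> x 0 i != x 0 j) ->
  (forall i j : 'I_n, i != j -> y 0 i != y 0 j) ->
  Sigma k (laxR mu N x (fun j => l%:R + \sum_i tanhR (mu * (x 0 j - y 0 i) / 2))) =
  \sum_(0 <= j < (minn k l).+1) esymOdd R l j *
    Sigma (k - j) (laxR mu n (- y) (fun i => l%:R + \sum_j tanhR (mu * (x 0 j - y 0 i) / 2))).
Proof.
move=> mu0 EN; subst N => xI yI.
(* The square roots [s] and [r] of [u] and [- v] are the diagonal gauges. The sign in [v] turns cosh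
   denominators into [u j - v i], which is positive. *)
pose s j := expR (mu * x 0 j / 2); pose r i := expR (mu * y 0 i / 2).
pose u j := s j ^+ 2; pose v i := - r i ^+ 2.
have s0 j : 0 < s j := expR_gt0 _; have r0 i : 0 < r i := expR_gt0 _.
have sq_inj (a b : R) : expR (mu * a / 2) ^+ 2 = expR (mu * b / 2) ^+ 2 -> a = b.
  move/eqP; rewrite eqrXn2 ?expR_ge0 // => /eqP/expR_inj E.
  by apply: (mulfI (lt0r_neq0 mu0)); lra.
have uI : injective u by move=> i j /sq_inj E; apply/eqP/negPn/negP => /xI; rewrite E eqxx.
have vI : injective v.
  by move=> i j /oppr_inj/sq_inj E; apply/eqP/negPn/negP => /yI; rewrite E eqxx.
have uv0 j i : u j - v i != 0 by rewrite /v opprK gt_eqF // addr_gt0 // exprn_gt0.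
have uv j i : u j != v i by rewrite -subr_eq0.
have uu j i : j != i -> u j - u i != 0 by rewrite subr_eq0 (inj_eq uI).
have vv j i : j != i -> v j - v i != 0 by rewrite subr_eq0 (inj_eq vI).
have tE j i : tanhR (mu * (x 0 j - y 0 i) / 2) = (u j + v i) / (u j - v i).
  by rewrite tanhR_expR /v opprK.
transitivity (Sigma k (cauchyA u v)).
  apply: (Sigma_conj _ _ _ _ _ s) => [j|i j]; first by rewrite gt_eqF.
  rewrite !mxE; case: (i =P j) => [<-|/eqP ij].
    rewrite mulrC; congr (_ * _).
    have -> : \sum_j tanhR (mu * (x 0 i - y 0 j) / 2) = n%:R + 2 * \sum_j v j / (u i - v j).
      rewrite -(sum1_ord R n) mulr_sumr -big_split; apply: eq_bigr => j' _ /=.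
      rewrite tE; field; exact: uv0.
    have -> : \sum_(j | j != i) cothR (mu * (x 0 i - x 0 j) / 2) =
        ((n + l)%:R - 1) + 2 * \sum_(j | j != i) u j / (u i - u j).
      rewrite -(sum1_neq _ _ i) mulr_sumr -big_split; apply: eq_bigr => j' ji /=.
      have uij : u i - u j' != 0 by rewrite uu // eq_sym.
      rewrite cothR_expR // -/(s i) -/(s j') -/(u i) -/(u j'); field; exact: uij.
    rewrite natrD; ring.
  have uij := uu _ _ ij; rewrite sinhRV_expR // -/(s i) -/(s j); rewrite /u in uij *; field; exact: uij.
(* Since sinh is odd, the off-diagonal part at [- y] is the transpose of that at [y]; transposing
   restores the orientation of [cauchyB]. *)
rewrite Sigma_cauchy //; apply: eq_bigr => e _; congr (_ * _); rewrite -[RHS]Sigma_tr.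
apply: (Sigma_conj _ _ _ _ _ r) => [j|i j]; first by rewrite gt_eqF.
rewrite !mxE [j == i]eq_sym; case: (i =P j) => [<-|/eqP ij].
  rewrite mulrC; congr (_ * _).
  have -> : \sum_j tanhR (mu * (x 0 j - y 0 i) / 2) =
      2 * \sum_j u j / (u j - v i) - (n + l)%:R.
    rewrite -(sum1_ord R (n + l)) mulr_sumr -sumrB; apply: eq_bigr => j' _ /=.
    rewrite tE; field; exact: uv0.
  have -> : \sum_(j | j != i) cothR (mu * (- y 0 i - (- y) 0 j) / 2) =
      2 * (\sum_(j | j != i) v j / (v j - v i)) - (n%:R - 1).
    rewrite -(sum1_neq _ _ i) mulr_sumr -sumrB; apply: eq_bigr => j' ji /=.
    have vij := vv _ _ ji; rewrite !mxE.
    have -> : - y 0 i - - y 0 j' = y 0 j' - y 0 i by rewrite opprK addrC.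
    have rij : r j' ^+ 2 - r i ^+ 2 != 0 by move: vij; rewrite /v -opprB oppr_eq0 opprK addrC.
    rewrite cothR_expR // -/(r i) -/(r j').
    have -> : v j' / (v j' - v i) = r j' ^+ 2 / (r j' ^+ 2 - r i ^+ 2).
      by rewrite /v -opprD invrN mulrNN.
    field; exact: rij.
  rewrite natrD; ring.
have vij := vv _ _ ij.
have -> : - y 0 j - - y 0 i = y 0 i - y 0 j by rewrite opprK addrC.
have rij : r i ^+ 2 - r j ^+ 2 != 0 by move: vij; rewrite /v -opprB oppr_eq0 opprK addrC.
rewrite sinhRV_expR // -/(r i) -/(r j).
have -> : 2 * v i / (v i - v j) = 2 * r i ^+ 2 / (r i ^+ 2 - r j ^+ 2).
  by rewrite /v -opprD invrN !mulrN mulNr opprK.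
field; exact: rij.
Qed.

(** * The action of both operators on the kernel, and the conclusion *)

Lemma SigmaOp_Kern {R : realType} (hb mu g : R) (N l k : nat)
    (x : 'rV[R]_N) (y : 'rV[R]_(N - l)) : 0 < hb ->
  SigmaOp hb mu g k (fun x' => Kern hb mu g x' y) x =
  ('i * (mu * g / 2)%:C)%C ^+ k *
  (Sigma k (laxR mu N x (fun j => l%:R + \sum_i tanhR (mu * (x 0 j - y 0 i) / 2))))%:C%C *
  (Kern hb mu g x y)%:C%C.
Proof.
move=> hb0; rewrite /SigmaOp.
rewrite (sum_SigmaPoly_expR _ _ _ _ _ _ _ _ _ _ _
  (fun m t => is_derive_sum_ln_coshR _ _ _ _ t (fun n => - (mu / 2 * y 0 n)))
  (Kern_xE hb mu g N l y)).
congr (_ * _); rewrite -Sigma_map -SigmaZ; congr (Sigma k _).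
apply: map_LnrE => j.
rewrite -[LHS]mulrA -[RHS]mulrA -!rmorphM mulNr -mulrN -rmorphN /=; congr (_ * (_)%:C)%C.
rewrite (eq_bigr (fun i => tanhR (mu * (x 0 j - y 0 i) / 2))) => [|i _].
  by field; rewrite gt_eqF.
by congr tanhR; ring.
Qed.

Lemma SigmaOpNeg_Kern {R : realType} (hb mu g : R) (N l k : nat)
    (x : 'rV[R]_N) (y : 'rV[R]_(N - l)) : 0 < hb ->
  SigmaOpNeg hb mu g k (fun y' => Kern hb mu g x y') y =
  ('i * (mu * g / 2)%:C)%C ^+ k *
  (Sigma k (laxR mu (N - l) (- y) (fun i => l%:R + \sum_j tanhR (mu * (x 0 j - y 0 i) / 2))))%:C%C *
  (Kern hb mu g x y)%:C%C.
Proof.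
move=> hb0; rewrite /SigmaOpNeg.
(* The sign of [- d/dy] turns [- i hb] into [i hb]. This compensates the opposite sign of the
   logarithmic derivative in [y], so the same prefactor [i mu g / 2] appears as in [x]. *)
under eq_bigr do rewrite -[_ * _ * _ ^+ _]mulrA -exprMn mulrN1 mulNr opprK.
rewrite (sum_SigmaPoly_expR _ _ _ _ _ _ _ _ _ _ _
  (fun n t => is_derive_sum_ln_coshR _ _ _ _ t (fun m => mu / 2 * x 0 m))
  (Kern_yE hb mu g N l x)).
congr (_ * _); rewrite -Sigma_map -SigmaZ; congr (Sigma k _).
apply: map_LnrE => j.
rewrite -[LHS]mulrA -[RHS]mulrA -!rmorphM /=; congr (_ * (_)%:C)%C.
rewrite (eq_bigr (fun i => tanhR (mu * (x 0 i - y 0 j) / 2))) => [|i _].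
  by field; rewrite gt_eqF.
by congr tanhR; ring.
Qed.

Theorem theorem4p1 (R : realType) (hb mu g : R) (N l k : nat)
  (x : 'rV[R]_N) (y : 'rV[R]_(N - l)) :
  0 < hb -> 0 < mu -> 0 < g ->
  (l <= N)%N -> (1 <= k <= N)%N ->
  (forall i j : 'I_N, i != j -> x 0 i != x 0 j) ->
  (forall i j : 'I_(N - l), i != j -> y 0 i != y 0 j) ->
  SigmaOp hb mu g k (fun x' => Kern hb mu g x' y) x =
  \sum_(0 <= j < (minn k l).+1)
     cLJ mu g l j * SigmaOpNeg hb mu g (k - j) (fun y' => Kern hb mu g x y') y.
Proof.
move=> hb0 mu0 g0 lN _ xI yI.
rewrite SigmaOp_Kern // (Sigma_laxR mu N (N - l) l k x y mu0 (esym (subnK lN)) xI yI).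
rewrite rmorph_sum mulr_sumr mulr_suml; apply: eq_big_nat => j /andP[_].
rewrite ltnS leq_min => /andP[jk _].
rewrite SigmaOpNeg_Kern // /cLJ /= [(esymOdd R l j * _)%:C%C]rmorphM /=.
(* The power [j] belongs to [cLJ], the power [k - j] to the operator in [y]. *)
have -> : ('i * (mu * g / 2)%:C)%C ^+ k =
    ('i * (mu * g / 2)%:C)%C ^+ j * ('i * (mu * g / 2)%:C)%C ^+ (k - j).
  by rewrite -exprD subnKC.
ring.
Qed.
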